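(* Let $k\ge 2$ and let $p$ be either $1$ or a prime. Then for all $n\ge 0$, $$a_{p,k}(n+1)-a_{p,k}(n)=a_{p,k-1}(n).$$
   Context: A partition of $n$ is a weakly decreasing finite sequence of positive integers summing to $n$; $\mathcal P(n)$ is the set of partitions of $n$ (the empty partition being the unique partition of $0$). For a partition $\lambda$ and positive integer $i$, $m_\lambda(i)$ is the number of parts equal to $i$. For $\lambda=(\lambda_1,\ldots,\lambda_\ell)$ with $\ell\ge k$, $\mathrm{pre}_k(\lambda)$ is the partition whose parts are the $\binom{\ell}{k}$ products $\lambda_{i_1}\cdots\lambda_{i_k}$ over all $1\le i_1<\cdots<i_k\le\ell$ (with multiplicity); it is undefined if $\ell<k$. In particular $\mathrm{pre}_1(\lambda)=\lambda$. $\mathrm{pre}_k(\mathcal P(n))$ is the set of $\mathrm{pre}_k(\lambda)$ for $\lambda\in\mathcal P(n)$ with at least $k$ parts, and $a_{i,k}(n)=\sum_{\nu\in\mathrm{pre}_k(\mathcal P(n))} m_\nu(i)$. *)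

(* Defs.v *)
From mathcomp Require Import all_boot finmap.

Set Implicit Arguments.
Unset Strict Implicit.
Unset Printing Implicit Defensive.

Local Open Scope fset_scope.

Definition is_partition (n : nat) (s : seq nat) : bool :=
  [&& sorted geq s, all (ltn 0) s & sumn s == n].

(* A partition of n has at most n parts, each at most n, hence the finite
   enumeration below; in_partitions shows that these bounds lose nothing. *)
Definition partitions (n : nat) : {fset seq nat} :=
  [fset s in [seq map val (val t) | t : n.-bseq 'I_n.+1] | is_partition n s].

Lemma in_partitions (n : nat) (s : seq nat) :
  (s \in partitions n) = is_partition n s.
Proof.
rewrite !inE; apply/andP/idP => [[]//|/[dup] sP /and3P[_ s_gt0 /eqP sum_s]].
split=> //; have size_le : size s <= n.
  rewrite -{}sum_s {sP}; elim: s s_gt0 => //= x s IHs /andP[x_gt0 /IHs].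
  by move=> IH; rewrite -add1n leq_add.
have part_le : all (leq^~ n) s.
  apply/allP => x xs; rewrite -sum_s (sumnE s) (big_rem x) //=; exact: leq_addr.
have size_le' : size [seq (inord x : 'I_n.+1) | x <- s] <= n by rewrite size_map.
apply/imageP; exists (Bseq size_le') => //=.
rewrite -map_comp -[LHS]map_id; apply/eq_in_map => x /(allP part_le) x_le /=.
by rewrite inordK.
Qed.

(* Multiplicity is kept because the products are listed by sets of positions.
   pre k s is only meaningful when k <= size s. *)
Definition pre (k : nat) (s : seq nat) : seq nat :=
  sort geq [seq \prod_(i in A) nth 0 s i
           | A : {set 'I_(size s)} in [pred A : {set 'I_(size s)} | #|A| == k]].

(* An image set: distinct partitions of n with the same pre k count once. *)
Definition pre_partitions (k n : nat) : {fset seq nat} :=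
  [fset pre k s | s in partitions n & k <= size s].

Definition a_ (i k n : nat) : nat :=
  \sum_(v <- pre_partitions k n) count_mem i v.

(* Main.v *)
Require Import Defs.
From mathcomp Require Import all_boot all_order all_algebra.
From mathcomp Require Import finmap.

Import GRing.Theory.
Local Open Scope ring_scope.

(** The map pre_k is not injective on the partitions of n (for k = 3, both
    (9,2,2) and (6,6,1) go to (36)), but only those lambda for which p is a
    part of pre_k(lambda) contribute to a_{p,k}(n). Such a lambda has at least
    k - 1 ones, and is then determined by nu = pre_k(lambda): the number of
    ones of nu is C(m_1, k), which gives m_1, and for i >= 2 the number of parts
    of nu equal to i is C(m_1, k-1) m_i plus a term depending only on the parts
    of lambda smaller than i, which gives m_i recursively. Hence a_{p,k}(n) is
    the sum over all partitions of n of C(m_1, k) if p = 1, and of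
    C(m_1, k-1) m_p if p is prime. Partitions of n+1 without ones contribute 0,
    the others arise from partitions of n by adding a part 1, and the
    recurrence is Pascal's rule. *)

Section SubsetProducts.
Set Implicit Arguments.
Unset Strict Implicit.
Local Open Scope nat_scope.

(** * Products over sets of positions, listed recursively *)

Fixpoint prods (k : nat) (s : seq nat) : seq nat :=
  match k, s with
  | 0, _ => [:: 1]
  | _.+1, [::] => [::]
  | k'.+1, x :: s' => [seq x * y | y <- prods k' s'] ++ prods k s'
  end.

(** The split by whether [ord0] belongs to the set mirrors the two branches of [prods]: the head is
    chosen or skipped. *)
Lemma sum_set_ordS (n : nat) (F : {set 'I_n.+1} -> nat) :
  \sum_(A : {set 'I_n.+1}) F A =
  \sum_(B : {set 'I_n}) F (ord0 |: [set lift ord0 i | i in B]) +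
  \sum_(B : {set 'I_n}) F [set lift ord0 i | i in B].
Proof.
have ord0_lift (B : {set 'I_n}) : ord0 \notin [set lift ord0 i | i in B].
  by apply/imsetP => -[i _ /eqP]; rewrite (negPf (neq_lift _ _)).
have mem_lift (B : {set 'I_n}) i :
    (lift ord0 i \in [set lift ord0 j | j in B]) = (i \in B).
  by rewrite mem_imset //; exact: lift_inj.
rewrite (bigID (fun A : {set 'I_n.+1} => ord0 \in A)) /=; congr (_ + _).
- rewrite (reindex_onto (fun B : {set 'I_n} => ord0 |: [set lift ord0 i | i in B])
    (fun A => lift ord0 @^-1: A)) /=; last first.
    move=> A A0; apply/setP => i; rewrite !inE.
    case: (unliftP ord0 i) => [j ->|->]; last by rewrite eqxx A0.
    by rewrite mem_lift !inE eq_sym (negPf (neq_lift _ _)).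
  apply: eq_bigl => B; rewrite !inE eqxx /=; apply/eqP/setP => i.
  by rewrite !inE mem_lift eq_sym (negPf (neq_lift _ _)).
- rewrite (reindex_onto (fun B : {set 'I_n} => [set lift ord0 i | i in B])
    (fun A => lift ord0 @^-1: A)) /=; last first.
    move=> A A0; apply/setP => i.
    case: (unliftP ord0 i) => [j ->|->]; first by rewrite mem_lift !inE.
    by rewrite (negPf A0) (negPf (ord0_lift _)).
  apply: eq_bigl => B; rewrite ord0_lift /=; apply/eqP/setP => i.
  by rewrite !inE mem_lift.
Qed.

Lemma count_prods_sum (P : pred nat) (k : nat) (s : seq nat) :
  count P (prods k s) =
  \sum_(A : {set 'I_(size s)}) ((#|A| == k) && P (\prod_(i in A) nth 0 s i)).
Proof.
(* [P] must vary: choosing the head [x] replaces [P] by its preimage under multiplication by [x]. *)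
elim: s k P => [|x s IHs] k P.
  rewrite (big_pred1 set0) => [|A]; last first.
    by symmetry; apply/eqP/setP => -[].
  by rewrite cards0 big_set0; case: k => [|k] //=; rewrite addn0.
rewrite sum_set_ordS.
have prod_lift (B : {set 'I_(size s)}) :
    \prod_(i in [set lift ord0 i | i in B]) nth 0 (x :: s) i
    = \prod_(i in B) nth 0 s i.
  by rewrite big_imset //; move=> i j _ _; exact: lift_inj.
have card_lift (B : {set 'I_(size s)}) : #|[set lift ord0 i | i in B]| = #|B|.
  by rewrite card_imset //; exact: lift_inj.
have ord0_lift (B : {set 'I_(size s)}) :
    ord0 \notin [set lift ord0 i | i in B].
  by apply/imsetP => -[i _ /eqP]; rewrite (negPf (neq_lift _ _)).
under [X in _ = X + _]eq_bigr => B _ do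
  rewrite cardsU1 ord0_lift card_lift big_setU1 //= prod_lift add1n.
under [X in _ = _ + X]eq_bigr => B _ do rewrite card_lift prod_lift.
rewrite -IHs; case: k => [|k]; first by rewrite big1 //; case: (s).
rewrite [prods _ _]/= count_cat count_map; congr (_ + _).
by rewrite IHs; apply: eq_bigr => B _; rewrite eqSS.
Qed.

(** Sorting only permutes the products, so multiplicities can be computed on [prods], by induction
    on the list. *)
Lemma count_pre (v k : nat) (s : seq nat) :
  count_mem v (pre k s) = count_mem v (prods k s).
Proof.
rewrite count_prods_sum /pre (permP (permEl (perm_sort _ _))) count_map.
rewrite -sum1_count big_enum_cond /= big_mkcond /=.
by apply: eq_bigr => A _; rewrite inE; case: ifP.
Qed.

(** * Multiplicities of 1 and of primes among the products *)

Lemma size_prods (k : nat) (s : seq nat) : size (prods k s) = 'C(size s, k).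
Proof.
elim: s k => [|x s IHs] [|k] //=; rewrite ?bin0 //.
by rewrite size_cat size_map !IHs binS addnC.
Qed.

Lemma count_mem1_prods (k : nat) (s : seq nat) :
  count_mem 1 (prods k s) = 'C(count_mem 1 s, k).
Proof.
elim: s k => [|x s IHs] [|k] //=; rewrite ?bin0 //.
rewrite count_cat count_map IHs; case: (eqVneq x 1) => [->|x1].
  rewrite add1n binS addnC -(IHs k); congr (_ + _).
  by apply: eq_count => y /=; rewrite mul1n.
rewrite add0n (@eq_count _ _ pred0) ?count_pred0 // => y /=.
by rewrite muln_eq1 (negPf x1).
Qed.

(** A product of [k.+1] factors is prime to the value [p] only as one factor [p] and [k] factors
    1. *)
Lemma count_prime_prods (p k : nat) (s : seq nat) : prime p ->
  count_mem p (prods k.+1 s) = 'C(count_mem 1 s, k) * count_mem p s.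
Proof.
move=> p_pr; have p1 : p != 1 by apply: contraTneq p_pr => ->.
elim: s k => [|x s IHs] k; first by rewrite muln0.
rewrite [prods _ _]/= count_cat count_map IHs /=.
case: (eqVneq x 1) => [->|x1].
  rewrite [1 == p]eq_sym (negPf p1) add0n add1n.
  rewrite (@eq_count _ _ (pred1 p)) => [|y /=]; last by rewrite mul1n.
  case: k => [|k].
    have -> : prods 0 s = [:: 1] by case: (s).
    by rewrite /= [1 == p]eq_sym (negPf p1) !bin0.
  by rewrite IHs binS -mulnDl addnC.
rewrite add0n; case: (eqVneq x p) => [->|xp].
  rewrite mulnDr muln1 -count_mem1_prods; congr (_ + _).
  apply: eq_count => y /=.
  by rewrite -[X in _ == X]muln1 eqn_pmul2l ?prime_gt0.
rewrite add0n (@eq_count _ _ pred0) ?count_pred0 // => y /=.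
apply/eqP => xy; have := p_pr; rewrite -xy => xy_pr.
have /primeP[_ /(_ x)] := xy_pr.
by rewrite dvdn_mulr // xy (negPf x1) (negPf xp) => /(_ isT).
Qed.

(** * Recovering a partition from its products *)

Lemma prods_gt0 (k : nat) (s : seq nat) :
  all (ltn 0) s -> all (ltn 0) (prods k s).
Proof.
elim: s k => [|x s IHs] [|k] //= /andP[x_gt0 s_gt0].
rewrite all_cat all_map IHs // andbT; apply: sub_all (IHs k s_gt0) => y /=.
by rewrite muln_gt0 x_gt0.
Qed.

(** A product equal to [i] with some factor at least [i] consists of one factor [i] and [k] ones;
    every other such product uses only parts below [i]. *)
Lemma count_prods_filter_lt (i k : nat) (s : seq nat) :
  1 < i -> sorted geq s -> all (ltn 0) s ->
  count_mem i (prods k.+1 s) =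
  'C(count_mem 1 s, k) * count_mem i s +
  count_mem i (prods k.+1 (filter (gtn i) s)).
Proof.
move=> i_gt1; elim: s => [|x s IHs]; first by rewrite muln0.
move=> xs_sorted /andP[x_gt0 s_gt0].
(* The list is decreasing, so a head below [i] puts all parts below [i] and the filter changes
   nothing. *)
have [x_lt|x_ge] := ltnP x i.
  have xs_lt : all (gtn i) (x :: s).
    rewrite /= x_lt /=; apply: sub_all (order_path_min _ xs_sorted).
      by move=> y yx; exact: leq_ltn_trans x_lt.
    by move=> ? ? ? h1 h2; exact: leq_trans h2 h1.
  rewrite (all_filterP xs_lt) [X in _ * X](_ : _ = 0) ?muln0 //.
  apply/eqP; rewrite -leqn0 leqNgt -has_count -all_predC.
  by apply: sub_all xs_lt => y /= /ltn_eqF ->.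
have -> : filter (gtn i) (x :: s) = filter (gtn i) s by rewrite /= ltnNge x_ge.
rewrite [prods _ _]/= count_cat count_map IHs ?(path_sorted xs_sorted) //=.
have /gtn_eqF -> : 1 < x by exact: leq_trans x_ge.
rewrite add0n mulnDr addnA; congr (_ + _ + _); have [->|xi] := eqVneq x i.
  rewrite muln1 -count_mem1_prods; apply: eq_count => y /=.
  by rewrite -[X in _ == X]muln1 eqn_pmul2l // ltnW.
rewrite muln0; apply/eqP; rewrite -leqn0 leqNgt -has_count -all_predC.
apply: sub_all (prods_gt0 k s_gt0) => y /= y_gt0; apply: contra_neqN xi => /eqP xy.
by apply/eqP; rewrite eqn_leq x_ge -xy leq_pmulr.
Qed.

(** From [k] on, the binomial is strictly increasing in its upper argument: by Pascal's rule each
    increment is a positive ['C(a, k)]. *)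
Lemma bin_inj (k m n : nat) :
  k <= m -> k <= n -> 'C(m, k.+1) = 'C(n, k.+1) -> m = n.
Proof.
have lt_bin a b : k <= a -> a < b -> 'C(a, k.+1) < 'C(b, k.+1).
  move=> k_le ab; apply: leq_trans (leq_bin2l _ ab).
  by rewrite binS -[X in X < _]addn0 ltn_add2l bin_gt0.
move=> km kn eq_bin; case: (ltngtP m n) => // [/(lt_bin _ _ km)|/(lt_bin _ _ kn)];
  by rewrite eq_bin ltnn.
Qed.

Lemma prods_inj (k : nat) (s t : seq nat) :
  sorted geq s -> all (ltn 0) s -> sorted geq t -> all (ltn 0) t ->
  k <= count_mem 1 s -> k <= count_mem 1 t ->
  (forall v, count_mem v (prods k.+1 s) = count_mem v (prods k.+1 t)) -> s = t.
Proof.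
move=> s_sorted s_gt0 t_sorted t_gt0 ks kt eq_prods.
have geq_tr : transitive geq by move=> ? ? ? h1 h2; exact: leq_trans h2 h1.
have geq_anti : antisymmetric geq.
  by move=> x y h; apply/anti_leq; rewrite andbC.
have eq1 : count_mem 1 s = count_mem 1 t.
  by apply: (bin_inj ks kt); rewrite -!count_mem1_prods.
suff eq_count_mem i : count_mem i s = count_mem i t.
  apply: (sorted_eq geq_tr geq_anti) => //.
  by apply/allP => i _; rewrite /= eq_count_mem.
have [n] := ubnP i; elim: n => // n IHn in i *; rewrite ltnS => i_le.
case: i i_le => [_|[_|i]] //.
  have count0 u : all (ltn 0) u -> count_mem 0 u = 0.
    move=> u_gt0; apply/count_memPn; apply/negP => /(allP u_gt0).
    by rewrite /= ltnn.
  by rewrite !count0.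
(* By induction the smaller parts agree, so their contributions to the multiplicity of [i.+2]
   cancel, leaving a common positive factor ['C(m_1, k)]. *)
move=> i_le; have eq_filter : filter (gtn i.+2) s = filter (gtn i.+2) t.
  apply: (sorted_eq geq_tr geq_anti); rewrite ?sorted_filter //.
  apply/allP => j; rewrite mem_cat !mem_filter => j_in /=; rewrite !count_filter.
  have j_lt : j < i.+2 by case/orP: j_in => /andP[].
  have count_lt u : count (predI (pred1 j) (gtn i.+2)) u = count_mem j u.
    by apply: eq_count => x /=; case: eqP => // ->.
  by rewrite !count_lt IHn //; exact: leq_trans i_le.
have := eq_prods i.+2; rewrite (@count_prods_filter_lt _ _ s) //.
rewrite (@count_prods_filter_lt _ _ t) // eq_filter eq1 => /eqP.
by rewrite eqn_add2r eqn_pmul2l ?bin_gt0 // => /eqP.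
Qed.

(** * From a sum over the image set to a sum over partitions *)

Lemma ones_of_count_prods (p k : nat) (s : seq nat) : p = 1 \/ prime p ->
  0 < count_mem p (prods k.+1 s) -> k <= count_mem 1 s.
Proof.
case=> [->|p_pr]; first by rewrite count_mem1_prods bin_gt0 => /ltnW.
by rewrite count_prime_prods // muln_gt0 bin_gt0 => /andP[].
Qed.

Lemma a_sum (p k n : nat) : p = 1 \/ prime p ->
  a_ p k.+1 n = \sum_(s <- partitions n) count_mem p (prods k.+1 s).
Proof.
move=> hp; pose D := [seq s <- partitions n | p \in prods k.+1 s].
have p_notin v : p \notin v -> count_mem p v = 0 by move/count_memPn.
rewrite /a_ [LHS](bigID (fun v => p \in v)) /= [X in _ + X]big1 ?addn0 //.
rewrite [RHS](bigID (fun s => p \in prods k.+1 s)) /= [X in _ + X]big1 ?addn0;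
  last by move=> s; exact: p_notin.
rewrite -big_filter -[RHS]big_filter -/D.
under [RHS]eq_bigr => s _ do rewrite -count_pre.
rewrite -(big_map (pre k.+1) xpredT (count_mem p)).
have mem_pre s : (p \in pre k.+1 s) = (p \in prods k.+1 s).
  by rewrite -!has_pred1 !has_count count_pre.
(* The image of [D] has no repetitions because [pre k.+1] is injective on [D], where [prods_inj]
   applies. *)
apply/perm_big/uniq_perm.
- by rewrite filter_uniq // fset_uniq.
- rewrite map_inj_in_uniq ?filter_uniq ?fset_uniq // => s t.
  rewrite !mem_filter !in_partitions.
  move=> /andP[ps /and3P[s_sorted s_gt0 _]] /andP[pt /and3P[t_sorted t_gt0 _]].
  move=> eq_pre; apply: (@prods_inj k) => // [||v].
  + by apply: (@ones_of_count_prods p) => //; rewrite -has_count has_pred1.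
  + by apply: (@ones_of_count_prods p) => //; rewrite -has_count has_pred1.
  + by rewrite -!count_pre eq_pre.
- move=> v; rewrite mem_filter; apply/andP/mapP.
    move=> [pv /imfsetP[s /= /andP[s_in _] v_def]].
    by exists s; rewrite // mem_filter s_in andbT -mem_pre -v_def.
  move=> [s]; rewrite mem_filter => /andP[ps s_in] ->; rewrite mem_pre ps.
  (* The size condition in [pre_partitions] holds since [prods k.+1 s] contains [p], so its length
     ['C(size s, k.+1)] is positive. *)
  split=> //; apply/imfsetP; exists s => //=; rewrite inE /= s_in /= -bin_gt0.
  by rewrite -size_prods; case: (prods _ _) ps.
Qed.

(** * The recurrence in [n] *)

Lemma count_prods_rcons1 (p k : nat) (s : seq nat) : p = 1 \/ prime p ->
  count_mem p (prods k.+2 (rcons s 1)) =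
  count_mem p (prods k.+2 s) + count_mem p (prods k.+1 s).
Proof.
rewrite -cats1; case=> [->|p_pr].
  by rewrite !count_mem1_prods count_cat addn1 binS.
have p1 : (1 == p) = false by apply: contraTF p_pr => /eqP <-.
by rewrite !count_prime_prods // !count_cat /= p1 !addn0 addn1 binS mulnDl.
Qed.

(** With at least two factors, a product equal to [p] needs a factor 1; with a single factor this
    fails for prime [p], whence the bound 2 on [k] in the theorem. *)
Lemma count_prods_no1 (p k : nat) (s : seq nat) : p = 1 \/ prime p ->
  1 \notin s -> count_mem p (prods k.+2 s) = 0.
Proof.
move=> hp /count_memPn s1; apply/eqP; rewrite -leqn0 leqNgt.
by apply/negP => /(ones_of_count_prods hp); rewrite s1.
Qed.

Lemma perm_partitions_ones (n : nat) :
  perm_eq [seq s <- partitions n.+1 | 1 \in s]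
          [seq rcons s 1 | s <- partitions n].
Proof.
apply: uniq_perm.
- by rewrite filter_uniq // fset_uniq.
- by rewrite map_inj_uniq ?fset_uniq //; exact: rcons_injl.
have is_partition_rcons s : is_partition n.+1 (rcons s 1) = is_partition n s.
  rewrite /is_partition all_rcons sumn_rcons addn1 eqSS /=.
  case s_gt0: (all _ s); rewrite ?andbF //=; congr (_ && _).
  case: s s_gt0 => //= x s s_gt0; rewrite rcons_path.
  by rewrite [X in _ && X](allP (s_gt0 : all (ltn 0) (x :: s)) _ (mem_last x s))
             andbT.
move=> s; rewrite mem_filter; apply/andP/mapP => [|[t t_in ->]]; last first.
  by rewrite mem_rcons mem_head in_partitions is_partition_rcons -in_partitions.
rewrite in_partitions; case: (lastP s) => [[]|t x] //.
(* The last part is the smallest, and it is positive, so if 1 occurs at all then it occurs last. *)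
move=> [t1 tx_part]; have x1 : x = 1.
  case/and3P: tx_part => tx_sorted; rewrite all_rcons => /andP[x_gt0 _] _.
  apply/eqP; rewrite eqn_leq [0 < x]x_gt0 andbT.
  move: t1; rewrite mem_rcons inE => /predU1P[<- //|t1].
  have geq_tr : transitive geq by move=> ? ? ? h1 h2; exact: leq_trans h2 h1.
  move: tx_sorted; rewrite (sorted_pairwise geq_tr) pairwise_rcons.
  by case/andP => /allP/(_ _ t1).
exists t; last by rewrite x1.
by rewrite in_partitions -is_partition_rcons -x1.
Qed.

Lemma a_succ (p k n : nat) : p = 1 \/ prime p ->
  a_ p k.+2 n.+1 = a_ p k.+2 n + a_ p k.+1 n.
Proof.
move=> hp; rewrite !a_sum // (bigID (fun s => 1 \in s)) /= [X in _ + X]big1;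
  last by move=> s; exact: count_prods_no1.
rewrite addn0 -big_filter (perm_big _ (perm_partitions_ones n)) big_map -big_split.
by apply: eq_bigr => s _; exact: count_prods_rcons1.
Qed.

End SubsetProducts.

Theorem theorem3p4 (k p n : nat) (hk : (2 <= k)%N) (hp : p = 1%N \/ prime p) :
  (a_ p k n.+1)%:Z - (a_ p k n)%:Z = (a_ p k.-1 n)%:Z.
Proof.
case: k hk => [|[|k]] // _.
by rewrite a_succ // PoszD addrC addKr.
Qed.
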